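(* Let $A,B,C,D,E$ be the vertices of a regular pentagon, in consecutive order, and for distinct vertices $X,Y,Z$ let $(XYZ)$ denote the five-point betweenness relation defined in the context. Then this betweenness relation does not arise from an ordering: there is no total order $<$ on $\{A,B,C,D,E\}$ such that for all distinct vertices $X,Y,Z$ one has $(XYZ)$ if and only if $X<Y<Z$ or $Z<Y<X$.
   Context: Any three distinct vertices of a regular pentagon form an isosceles, non-equilateral triangle. For distinct vertices $X,Y,Z$ the relation $(XYZ)$ (''$Y$ is between $X$ and $Z$'') holds if and only if $Y$ is the common endpoint of the two equal sides (legs) of the triangle $XYZ$, i.e. $|XY|=|YZ|$. *)

(* Defs.v *)
From mathcomp Require Import all_boot all_order all_algebra.
From mathcomp Require Import reals trigo.

Set Implicit Arguments.
Unset Strict Implicit.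
Unset Printing Implicit Defensive.

Import Order.TTheory GRing.Theory Num.Theory.

Local Open Scope ring_scope.

Section Plane.
Variable R : realType.

(* The canonical norm on row vectors is the sup norm, so the Euclidean
   structure of the plane is spelled out here. *)
Definition dot (u v : 'rV[R]_2) : R := \sum_(i < 2) u 0 i * v 0 i.

Definition dist (P Q : 'rV[R]_2) : R := Num.sqrt (dot (P - Q) (P - Q)).

Definition angle (P Q S : 'rV[R]_2) : R :=
  acos (dot (P - Q) (S - Q) / (dist P Q * dist S Q)).

(* Twice the signed area of the triangle P Q S; its sign tells on which side
   of the line PQ the point S lies. *)
Definition orientation (P Q S : 'rV[R]_2) : R :=
  (Q 0 0 - P 0 0) * (S 0 1 - P 0 1) - (Q 0 1 - P 0 1) * (S 0 0 - P 0 0).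

(* Indices live in 'I_5, whose ring structure is arithmetic modulo 5. The
   vertices are strictly convex and listed in consecutive order: each side has
   all the other vertices strictly on one side of its line. This also excludes
   repeated points and the pentagram. *)
Definition convex_pentagon (P : 5.-tuple 'rV[R]_2) : Prop :=
  forall i : 'I_5,
    (forall j : 'I_5, j != i -> j != i + 1 ->
       0 < orientation (tnth P i) (tnth P (i + 1)) (tnth P j)) \/
    (forall j : 'I_5, j != i -> j != i + 1 ->
       orientation (tnth P i) (tnth P (i + 1)) (tnth P j) < 0).

Definition equilateral_pentagon (P : 5.-tuple 'rV[R]_2) : Prop :=
  forall i j : 'I_5,
    dist (tnth P i) (tnth P (i + 1)) = dist (tnth P j) (tnth P (j + 1)).

Definition equiangular_pentagon (P : 5.-tuple 'rV[R]_2) : Prop :=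
  forall i j : 'I_5,
    angle (tnth P (i - 1)) (tnth P i) (tnth P (i + 1)) =
    angle (tnth P (j - 1)) (tnth P j) (tnth P (j + 1)).

Definition regular_pentagon (P : 5.-tuple 'rV[R]_2) : Prop :=
  [/\ convex_pentagon P, equilateral_pentagon P & equiangular_pentagon P].

(* Only meant for pairwise distinct X, Y, Z. *)
Definition between (X Y Z : 'rV[R]_2) : Prop := dist X Y = dist Y Z.

End Plane.

Definition strict_total_order_on (T : eqType) (V : seq T)
    (lt : T -> T -> Prop) : Prop :=
  [/\ {in V, forall x, ~ lt x x},
      {in V & &, forall x y z, lt x y -> lt y z -> lt x z} &
      {in V &, forall x y, x <> y -> lt x y \/ lt y x}].

(* Main.v *)
Require Import Defs.
From mathcomp Require Import all_boot all_order all_algebra.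
From mathcomp Require Import reals trigo.

Set Implicit Arguments.
Unset Strict Implicit.
Unset Printing Implicit Defensive.

Import Order.TTheory GRing.Theory Num.Theory.

Local Open Scope ring_scope.

(** Three consecutive vertices X, Y, Z satisfy (XYZ), since the sides are
    equal.  An order inducing the betweenness relation is therefore monotone
    along each such triple, and hence all the way round the pentagon, which is
    impossible for a closed walk. *)

(** Allows a walk whose first step descends to be treated as one that ascends. *)
Lemma strict_total_order_on_converse (T : eqType) (V : seq T)
    (lt : T -> T -> Prop) :
  strict_total_order_on V lt -> strict_total_order_on V (fun x y => lt y x).
Proof.
case=> lt_irr lt_trans lt_total; split=> //.
- by move=> x y z Vx Vy Vz lt_yx lt_zy; apply: lt_trans lt_zy lt_yx.
- by move=> x y Vx Vy /(lt_total _ _ Vx Vy) [] ?; [right | left].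
Qed.

(** Successive triples share a step, so the ascent of the first step propagates to all; transitivity
    and irreflexivity then prevent a return to [p 0]. *)
Lemma no_monotone_closed_walk (T : eqType) (V : seq T) (lt : T -> T -> Prop)
    (p : nat -> T) (n : nat) :
  strict_total_order_on V lt -> (forall k, p k \in V) ->
  (forall k, lt (p k) (p k.+1) /\ lt (p k.+1) (p k.+2) \/
             lt (p k.+2) (p k.+1) /\ lt (p k.+1) (p k)) ->
  lt (p 0) (p 1) -> p n.+1 <> p 0.
Proof.
case=> lt_irr lt_trans _ Vp mono lt01.
have step k : lt (p k) (p k.+1).
  elim: k => // k lt_k; case: (mono k) => [[] //|[_ gt_k]].
  by case: (lt_irr (p k)) => //; apply: (lt_trans _ (p k.+1)).
have lt0 k : lt (p 0) (p k.+1).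
  by elim: k => // k lt0k; apply: (lt_trans _ (p k.+1)).
by move=> p_closed; apply: (lt_irr (p 0)) => //; rewrite -{2}p_closed.
Qed.

Lemma no_betweenness_closed_walk (T : eqType) (V : seq T)
    (lt : T -> T -> Prop) (p : nat -> T) (n : nat) :
  strict_total_order_on V lt -> (forall k, p k \in V) ->
  (forall k, lt (p k) (p k.+1) /\ lt (p k.+1) (p k.+2) \/
             lt (p k.+2) (p k.+1) /\ lt (p k.+1) (p k)) ->
  p n.+1 <> p 0.
Proof.
move=> lt_order Vp mono; case: (mono 0) => [[lt01 _]|[_ lt10]].
  exact: no_monotone_closed_walk lt_order Vp mono lt01.
apply: no_monotone_closed_walk (strict_total_order_on_converse lt_order) Vp _ lt10.
by move=> k; case: (mono k) => -[? ?]; [right | left].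
Qed.

(** A triangle with two coinciding vertices has area zero. *)
Lemma orientation_neq0_distinct (R : realType) (X Y Z : 'rV[R]_2) :
  orientation X Y Z != 0 -> [/\ X <> Y, Y <> Z & X <> Z].
Proof.
move=> /eqP XYZ; split=> eqv; apply: XYZ; rewrite /orientation eqv.
- by rewrite !subrr !mul0r subrr.
- by rewrite mulrC subrr.
- by rewrite !subrr !mulr0 subrr.
Qed.

Lemma convex_pentagon_consecutive_distinct (R : realType)
    (P : 5.-tuple 'rV[R]_2) (i : 'I_5) :
  convex_pentagon P ->
  [/\ tnth P i <> tnth P (i + 1), tnth P (i + 1) <> tnth P (i + 1 + 1)
    & tnth P i <> tnth P (i + 1 + 1)].
Proof.
move=> /(_ i) convP; apply: orientation_neq0_distinct.
(* Strict convexity at side [i] is applied to the vertex [i + 1 + 1], which must not be an endpoint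
   of that side; cancelling leaves closed inequalities modulo 5. *)
have neq_i : i + 1 + 1 != i
  by rewrite -addrA -[X in _ != X]addr0 (inj_eq (addrI i)).
have neq_i1 : i + 1 + 1 != i + 1
  by rewrite -[X in _ != X]addr0 (inj_eq (addrI (i + 1))).
by case: convP => /(_ _ neq_i neq_i1); [move/lt0r_neq0 | move/ltr0_neq0].
Qed.

Theorem mainTheorem2 (R : realType) (A B C D E : 'rV[R]_2) :
  regular_pentagon [tuple A; B; C; D; E] ->
  ~ exists lt : 'rV[R]_2 -> 'rV[R]_2 -> Prop,
      strict_total_order_on [:: A; B; C; D; E] lt /\
      {in [:: A; B; C; D; E] & &, forall X Y Z,
         X <> Y -> Y <> Z -> X <> Z ->
         (between X Y Z <-> (lt X Y /\ lt Y Z) \/ (lt Z Y /\ lt Y X))}.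
Proof.
set P := [tuple A; B; C; D; E].
case=> convP sidesP _ [lt [lt_order betweenE]].
(* The cast [k%:R] into ['I_5] reduces modulo 5, so [p] circles the pentagon indefinitely and closes
   up after five steps. *)
pose p k := tnth P k%:R.
have Vp k : p k \in [:: A; B; C; D; E] by exact: mem_tnth.
have p5 : p 5 = p 0 by congr tnth; apply: val_inj.
apply: (no_betweenness_closed_walk lt_order Vp _ p5) => k.
have [] := convex_pentagon_consecutive_distinct k%:R convP.
rewrite !natr1 => neq01 neq12 neq02.
apply: (betweenE _ _ _ (Vp k) (Vp k.+1) (Vp k.+2) neq01 neq12 neq02).1.
(* Equality of the adjacent sides [k] and [k.+1] is exactly [between] for the triple. *)
by have := sidesP k%:R k.+1%:R; rewrite !natr1.
Qed.
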